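(* Assume that $X$ is a convex, closed and non-empty subset of $\mathbb{R}^n=\prod_{\nu\in N}\mathbb{R}^{n_\nu}$, and that for each $\nu\in N$ the objective function $\theta_\nu:\mathbb{R}^n\to\mathbb{R}$ is continuous. Suppose there exists $\rho>0$ such that (i) $X\cap\overline{B}_\rho\ne\emptyset$, and (ii) for each $x\in X$ with $\|x\|=\rho$ there exists $y\in X$ such that $\|y\|<\rho$ and $\theta_\nu(y^\nu,x^{-\nu})\le\theta_\nu(x)$ for all $\nu\in N$. If each $\theta_\nu$ is convex with respect to its player's variable, then the set $\mathrm{RGNEP}(\{\theta_\nu,X\}_{\nu\in N})$ is non-empty.
   Context: $N$ is a finite non-empty set of players. For $x\in\mathbb{R}^n$, write $x=(x^\nu,x^{-\nu})$, where $x^\nu\in\mathbb{R}^{n_\nu}$ is the component of player $\nu$ and $x^{-\nu}$ collects the components of the other players. $\|\cdot\|$ is a norm on $\mathbb{R}^n$ and $\overline{B}_\rho=\{x\in\mathbb{R}^n:\|x\|\le\rho\}$. $\theta_\nu$ is convex with respect to its player's variable if $\theta_\nu(\cdot,x^{-\nu})$ is convex on $\mathbb{R}^{n_\nu}$ for every $x^{-\nu}$. $\mathrm{RGNEP}(\{\theta_\nu,X\}_{\nu\in N})$ is the set of generalized Nash equilibria of Rosen's game: all $\hat x\in X$ such that for every $\nu\in N$ and every $x^\nu\in\mathbb{R}^{n_\nu}$ with $(x^\nu,\hat x^{-\nu})\in X$ one has $\theta_\nu(\hat x)\le\theta_\nu(x^\nu,\hat x^{-\nu})$. *)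

(* Defs.v *)
From HB Require Import structures.
From mathcomp Require Import all_boot all_order all_algebra.
From mathcomp Require Import all_classical all_reals all_analysis.

Set Implicit Arguments.
Unset Strict Implicit.
Unset Printing Implicit Defensive.

Import Order.TTheory GRing.Theory Num.Theory.
Import numFieldNormedType.Exports.

Local Open Scope classical_set_scope.
Local Open Scope ring_scope.

(* R^n = \prod_(nu in N) R^(n nu), with the product topology and the pointwise
   vector space structure. *)
Definition profile (R : realType) (N : finType) (n : N -> nat) : Type :=
  prod_topology (fun nu : N => 'rV[R]_(n nu)).

Section ProfileSpace.
Context (R : realType) (N : finType) (n : N -> nat).
Local Notation V := (@profile R N n).

HB.instance Definition _ := Choice.copy V (forall nu : N, 'rV[R]_(n nu)).
HB.instance Definition _ :=
  Topological.copy V (prod_topology (fun nu : N => 'rV[R]_(n nu))).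

Definition profile_zero : V := fun nu => 0.
Definition profile_opp (x : V) : V := fun nu => - x nu.
Definition profile_add (x y : V) : V := fun nu => x nu + y nu.
Definition profile_scale (a : R) (x : V) : V := fun nu => a *: x nu.

Fact profile_addA : associative profile_add.
Proof.
by move=> x y z; apply: functional_extensionality_dep => nu; exact: addrA.
Qed.
Fact profile_addC : commutative profile_add.
Proof.
by move=> x y; apply: functional_extensionality_dep => nu; exact: addrC.
Qed.
Fact profile_add0 : left_id profile_zero profile_add.
Proof.
by move=> x; apply: functional_extensionality_dep => nu; exact: add0r.
Qed.
Fact profile_addN : left_inverse profile_zero profile_opp profile_add.
Proof.
by move=> x; apply: functional_extensionality_dep => nu; exact: addNr.
Qed.

HB.instance Definition _ := GRing.isZmodule.Build V
  profile_addA profile_addC profile_add0 profile_addN.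

Fact profile_scaleA (a b : R) (x : V) :
  profile_scale a (profile_scale b x) = profile_scale (a * b) x.
Proof. by apply: functional_extensionality_dep => nu; exact: scalerA. Qed.
Fact profile_scale1 : left_id 1 profile_scale.
Proof.
by move=> x; apply: functional_extensionality_dep => nu; exact: scale1r.
Qed.
Fact profile_scaleDr : right_distributive profile_scale +%R.
Proof.
by move=> a x y; apply: functional_extensionality_dep => nu; exact: scalerDr.
Qed.
Fact profile_scaleDl (x : V) : {morph profile_scale^~ x : a b / a + b}.
Proof.
by move=> a b; apply: functional_extensionality_dep => nu; exact: scalerDl.
Qed.

HB.instance Definition _ := GRing.Zmodule_isLmodule.Build R V
  profile_scaleA profile_scale1 profile_scaleDr profile_scaleDl.

(* [unilateral x nu z] is (z, x^{-nu}); it does not depend on [x nu]. *)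
Definition unilateral (x : V) (nu : N) (z : 'rV[R]_(n nu)) : V :=
  dfwith x nu z.

Local Arguments unilateral : clear implicits.

(* The axioms of the factory Lmodule_isNormed; nonnegativity follows. *)
Definition is_norm (nrm : V -> R) : Prop :=
  [/\ forall x y, nrm (x + y) <= nrm x + nrm y,
      forall (a : R) x, nrm (a *: x) = `|a| * nrm x &
      forall x, nrm x = 0 -> x = 0].

Definition norm_closed_ball (nrm : V -> R) (rho : R) : set V :=
  [set x | nrm x <= rho].

Definition player_convex (nu : N) (f : V -> R) : Prop :=
  forall x : V,
    convex_function [set: 'rV[R]_(n nu)] (fun z => f (unilateral x nu z)).

Definition RGNEP (theta : N -> V -> R) (X : set V) : set V :=
  [set x | X x /\
     forall (nu : N) (z : 'rV[R]_(n nu)),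
       X (unilateral x nu z) -> theta nu x <= theta nu (unilateral x nu z)].

End ProfileSpace.

Arguments unilateral {R N n} x nu z.

(* Main.v *)
Require Import Defs.
From HB Require Import structures.
From mathcomp Require Import all_boot all_order all_algebra.
From mathcomp Require Import zify lra.

(** Let K be the part of X inside the closed ball of radius rho and consider
    the Nikaido-Isoda function Psi x y, the sum over the players of
    theta_nu (y^nu, x^-nu) - theta_nu x.  It is continuous in x, convex in y and
    vanishes on the diagonal, and K is convex and compact because the ball of
    any norm on a finite-dimensional space is compact
    ([compact_norm_closed_ball]).  Ky Fan's inequality ([ky_fan]) gives a point
    x of K with Psi x y >= 0 for all y in K.  This inequality extends from K to
    X.  Some y0 in X with norm < rho has Psi x y0 <= 0: take x itself when x is
    in the open ball, and the point given by the coercivity condition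
    otherwise.  For y1 in X the segment from y0 to y1 stays in K for a while,
    and convexity of Psi x along it gives
      0 <= Psi x (t y1 + (1 - t) y0) <= t Psi x y1   for some t > 0.
    Taking for y1 a unilateral deviation of player nu from x, all terms of
    Psi x y1 but the nu-th cancel, and what remains is the equilibrium
    inequality for nu.

    Ky Fan's inequality is a form of Brouwer's theorem and is derived here from
    a combinatorial theorem of Scarf.  By compactness of K only finitely many
    test points y_i matter, so x can be sought among their barycenters.  It
    suffices to find barycentric weights w whose support consists of indices
    minimizing Psi x y_i, for x the barycenter of w ([best_response_weights]):
    if some Psi x y_i were negative, it would be so on the whole support of w,
    hence Psi x x < 0 by convexity.  Such weights are a limit of approximate
    ones: on the grid of weights with denominator k, colour each point by a
    minimizing index; Scarf's theorem gives a set of grid points of diameter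
    O(1/k) that carries every colour i for which w_i is not itself O(1/k)
    ([small_rainbow]).  Scarf's theorem ([rainbow_dominant]) replaces the
    triangulation in Sperner's lemma by a family of linear orders, one for each
    colour, and is proved by the same parity argument. *)

Set Implicit Arguments.
Unset Strict Implicit.
Unset Printing Implicit Defensive.

(** * Scarf's theorem on families of linear orders *)

Section Scarf.
(* Each colour i linearly orders V through the injective rank rk i.  The slack
   vertices play the part of the boundary of the simplex: slack i is the
   smallest vertex for its own order and lies above all ordinary vertices for
   the other orders. *)
Context {V I : finType} (rk : I -> V -> nat) (slack : I -> V).
Context (rk_inj : forall i, injective (rk i)).
Context (slack_min : forall i v, rk i (slack i) <= rk i v).
Context (slack_big : forall i j v,
  j != i -> v \notin codom slack -> rk i v < rk i (slack j)).

(** The dominant sets are the simplices of an abstract complex; those with #|I|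
    elements are its facets. *)
Definition dominant (S : {set V}) :=
  [forall y, exists i, forall x in S, rk i y <= rk i x].

Lemma dominantP (S : {set V}) :
  reflect (forall y, exists i, forall x, x \in S -> rk i y <= rk i x)
          (dominant S).
Proof.
apply: (iffP forallP) => h y.
  by have /existsP[i /forall_inP hi] := h y; exists i.
by have [i hi] := h y; apply/existsP; exists i; apply/forall_inP.
Qed.

Lemma dominantS (S S' : {set V}) : S \subset S' -> dominant S' -> dominant S.
Proof.
move=> /subsetP sSS' /dominantP h; apply/dominantP => y.
by have [i hi] := h y; exists i => x /sSS'; apply: hi.
Qed.

Definition extensions (S : {set V}) :=
  [set x | (x \notin S) && dominant (x |: S)].

Section Extensions.
(* mu i is the minimum of S for the i-th order. *)
Context (S : {set V}) (mu : I -> V).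
Context (mu_in : forall i, mu i \in S).
Context (mu_min : forall i x, x \in S -> rk i (mu i) <= rk i x).

(** Adding one of these vertices to S can change its minimum for the order d
    only. *)
Definition above (d : I) : {set V} :=
  [set y | [forall e, (e != d) ==> (rk e (mu e) < rk e y)]].

Definition highest (d : I) : {set V} :=
  [set x in above d | [forall y in above d, rk d y <= rk d x]].

Lemma aboveP d y :
  reflect (forall e, e != d -> rk e (mu e) < rk e y) (y \in above d).
Proof. by rewrite inE; apply: (iffP forall_inP). Qed.

Lemma card_highest d : #|highest d| = (above d != set0).
Proof.
case: (set_0Vmem (above d)) => [A0|[x0 x0A]].
  rewrite A0 eqxx; apply/eqP; rewrite cards_eq0; apply/eqP/setP => x.
  by rewrite /highest A0 !inE.
have -> : above d != set0 by apply/set0Pn; exists x0.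
case: (arg_maxnP (rk d) x0A) => x xA xmax.
apply/eqP/cards1P; exists x; apply/setP => y; rewrite !in_set1 inE.
apply/andP/eqP => [[yA /forall_inP ymax]|->].
  by apply: (@rk_inj d); apply/eqP; rewrite eqn_leq ymax // andbT; exact: xmax.
by split=> //; apply/forall_inP.
Qed.

Context (domS : dominant S).

Lemma mu_surj x : x \in S -> exists i, mu i = x.
Proof.
move=> xS; have /dominantP/(_ x)[i hi] := domS; exists i.
by apply: (@rk_inj i); apply/eqP; rewrite eqn_leq mu_min //= hi.
Qed.

(** The #|I| minima of S exhaust its #|I| - 1 elements, so exactly one element
    of S is a minimum twice, for orders i and j.  A vertex x that extends S to a
    dominant set is a new minimum for some order d; the old minimum mu d must
    still be a minimum of the larger set, hence d is i or j, and by dominance x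
    is then the largest, for the order d, of the vertices above all the other
    minima. *)
Lemma extensionsE : #|S|.+1 = #|I| ->
  exists i j, [/\ i != j, mu i = mu j, [disjoint above i & S],
    [disjoint above j & S] & #|extensions S| = #|highest i| + #|highest j|].
Proof.
move=> cardS.
have muT : mu @: [set: I] = S.
  apply/setP => x; apply/imsetP/idP => [[i _ ->] //|/mu_surj[i <-]].
  by exists i.
have [i [j [ij muij]]] : exists i j, i != j /\ mu i = mu j.
  have : ~~ injectiveb mu.
    apply/negP => /injectiveP inj.
    by move: (card_imset [set: I] inj); rewrite muT cardsT; lia.
  by move/injectivePn => [i [j ij muij]]; exists i, j.
have inj_off d e : d != e -> mu d = mu e ->
    {in [set~ d] &, injective mu}.
  move=> de mude; apply/imset_injP; apply/eqP.
  have -> : mu @: [set~ d] = S.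
    apply/setP => x; apply/imsetP/idP => [[k _ ->] //|/mu_surj[k <-]].
    have [->|kd] := eqVneq k d; last by exists k; rewrite ?inE.
    by exists e; rewrite // !inE eq_sym.
  by rewrite cardsC1 -cardS.
have twins d e : d != e -> mu d = mu e -> (d == i) || (d == j).
  move=> de mude; apply/negPn; rewrite negb_or; apply/negP => /andP[di dj].
  have := inj_off _ _ de mude i j; rewrite !inE => /(_ _ _ muij) ij'.
  by move: ij; rewrite ij' ?eqxx // eq_sym.
have twin d : (d == i) || (d == j) -> exists2 e, e != d & mu e = mu d.
  by case/orP => /eqP ->; [exists j => //; rewrite eq_sym | exists i].
have aboveNS d : (d == i) || (d == j) -> [disjoint above d & S].
  move=> /twin[e ed mued]; apply/pred0P => y /=; apply/negP.
  move=> /andP[/aboveP yA yS]; have [k muk] := mu_surj yS.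
  have [kd|kd] := eqVneq k d; last by have := yA _ kd; rewrite muk ltnn.
  by have := yA _ ed; rewrite mued -kd muk ltnn.
exists i, j; split=> //; try by apply: aboveNS; rewrite eqxx ?orbT.
have -> : extensions S = highest i :|: highest j.
  apply/setP => x; rewrite in_setU inE; apply/andP/orP => [[xS domx]|].
  (* If x dethrones mu d, then mu d remains a minimum for another order e. *)
  + have new d : rk d x < rk d (mu d) ->
        exists2 e, e != d & mu e = mu d /\ rk e (mu e) < rk e x.
      move=> xd; have /dominantP/(_ (mu d))[e he] := domx.
      have le_x : rk e (mu d) <= rk e x by apply: he; rewrite !inE eqxx.
      have mue : mu e = mu d.
        apply: (@rk_inj e); apply/eqP; rewrite eqn_leq mu_min //= he //.
        by rewrite !inE mu_in orbT.
      exists e; first by apply: contraTneq le_x => ->; rewrite -ltnNge.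
      split=> //; rewrite ltn_neqAle mue le_x andbT.
      by apply: contraNneq xS => /rk_inj <-.
    (* x dethrones one minimum only: if it took the places of both mu i and
       mu j, their common value would no longer be a minimum. *)
    have new2 d e : e != d -> rk d x < rk d (mu d) -> rk e (mu e) < rk e x.
      move=> ed xd; rewrite ltn_neqAle leqNgt.
      apply/andP; split; first by apply: contraNneq xS => /rk_inj <-.
      apply/negP => xe; have [d' d'd [mud' xd']] := new _ xd.
      have [e' e'e [mue' _]] := new _ xe.
      have d'e : d' != e by apply: contraTneq xe => <-; rewrite -leqNgt ltnW.
      have dij : (d == i) || (d == j) by apply: (twins _ d'); rewrite // eq_sym.
      have eij : (e == i) || (e == j) by apply: (twins _ e'); rewrite // eq_sym.
      have d'ij := twins _ _ d'd mud'; move: d'd d'e ed.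
      by case/orP: dij => /eqP ->; case/orP: eij => /eqP ->;
        case/orP: d'ij => /eqP ->; rewrite ?eqxx.
    have /dominantP/(_ x)[d hd] := domx.
    have xd : rk d x < rk d (mu d).
      rewrite ltn_neqAle hd ?andbT; last by rewrite !inE mu_in orbT.
      by apply: contraNneq xS => /rk_inj ->.
    have [e ed [mue _]] := new _ xd.
    suff xh : x \in highest d.
      have : (d == i) || (d == j) by apply: (twins _ e); rewrite // eq_sym.
      by case/orP => /eqP <-; [left|right].
    have xA : x \in above d by apply/aboveP => k kd; apply: new2 kd xd.
    rewrite inE xA; apply/forall_inP => y /aboveP yA; rewrite leqNgt.
    apply/negP => xy; have /dominantP/(_ y)[k hk] := domx.
    have [kd|kd] := eqVneq k d.
      by move: xy; rewrite ltnNge -kd hk // !inE eqxx.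
    by have := yA _ kd; rewrite ltnNge hk // !inE mu_in orbT.
  + have ext d : (d == i) || (d == j) -> x \in highest d ->
        x \notin S /\ dominant (x |: S).
      move=> dij; rewrite inE => /andP[xA /forall_inP xmax].
      split.
        by have /pred0P/(_ x)/= := aboveNS _ dij; rewrite xA /= => ->.
      apply/dominantP => y.
      have /dominantP/(_ y)[f hf] := domS.
      have [yA|] := boolP (y \in above d).
        exists d => z; rewrite !inE => /orP[/eqP ->|zS]; first exact: xmax.
        have [->|fd] := eqVneq d f; first exact: hf.
        have /aboveP/(_ f) := yA; rewrite eq_sym fd => /(_ isT).
        by rewrite ltnNge hf.
      move=> yA; have [e ed ye] : exists2 e, e != d & rk e y <= rk e (mu e).
        move: yA; rewrite inE negb_forall => /existsP[e].
        by rewrite negb_imply -leqNgt => /andP[]; exists e.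
      exists e => z; rewrite !inE => /orP[/eqP ->|zS].
        by apply: (leq_trans ye); apply: ltnW; move/aboveP: xA; apply.
      exact: leq_trans ye (mu_min _ zS).
    by case; apply: ext; rewrite eqxx ?orbT.
rewrite cardsU.
suff -> : highest i :&: highest j = set0 by rewrite cards0 subn0.
apply/setP => x; rewrite in_set0; apply/negP.
rewrite !inE -!andbA => /and4P[/forall_inP xi _ /forall_inP xj _].
have /dominantP/(_ x)[k hk] := domS.
have : rk k (mu k) < rk k x.
  by have [ki|ki] := eqVneq k i; [apply: xj; rewrite ki | apply: xi].
by rewrite ltnNge hk.
Qed.

End Extensions.

Lemma minima_exist (S : {set V}) : S != set0 ->
  exists mu : I -> V, (forall i, mu i \in S) /\
    (forall i x, x \in S -> rk i (mu i) <= rk i x).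
Proof.
case/set0Pn => x0 x0S; exists (fun i => [arg min_(x < x0 in S) rk i x]).
by split=> [i|i x xS]; case: arg_minnP => // y yS ymin; apply: ymin.
Qed.

(** Inside the complex a face of codimension 1 lies in two facets: above an
    ordinary vertex v, each of the two orders of [extensionsE] has room for at
    least a slack vertex. *)
Lemma even_extensions (S : {set V}) v : dominant S -> #|S|.+1 = #|I| ->
  v \in S -> v \notin codom slack -> ~~ odd #|extensions S|.
Proof.
move=> domS cardS vS vNslack.
have [|mu [mu_in mu_min]] := @minima_exist S; first by apply/set0Pn; exists v.
have [i [j [ij muij _ _ ->]]] := extensionsE mu_in mu_min domS cardS.
suff up d : above mu d != set0 by rewrite !card_highest !up.
apply/set0Pn; exists (slack d); apply/aboveP => e ed.
by apply: leq_ltn_trans (mu_min e v vS) (slack_big _ vNslack); rewrite eq_sym.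
Qed.

Context (t0 : V) (t0Nslack : t0 \notin codom slack).

Lemma slack_inj : injective slack.
Proof.
move=> i j eqij; apply/eqP; apply: contraT => ij.
by have := slack_big ij t0Nslack; rewrite eqij ltnNge slack_min.
Qed.

Lemma slack_lt i v : v \notin codom slack -> rk i (slack i) < rk i v.
Proof.
move=> vN; rewrite ltn_neqAle slack_min andbT.
by apply: contraNneq vN => /rk_inj <-; apply: codom_f.
Qed.

Lemma dominant_slack (i0 : I) : dominant (slack @: [set~ i0]).
Proof.
apply/dominantP => y; case: (boolP (y \in codom slack)) => [/codomP[j ->]|yN].
  by exists j => x _; apply: slack_min.
exists i0 => x /imsetP[e + ->]; rewrite !inE => ei.
by apply: ltnW; apply: slack_big.
Qed.

Lemma card_slack_facet (i0 : I) : #|slack @: [set~ i0]|.+1 = #|I|.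
Proof.
rewrite card_imset ?cardsC1; last exact: slack_inj.
by rewrite prednK //; apply/card_gt0P; exists i0.
Qed.

(** A boundary face, made of all slack vertices but one, lies in a single facet:
    of the two orders of [extensionsE] one is i0, for which all ordinary
    vertices are above the other minima, while for the other one, d, nothing can
    lie above both slack d for the order i0 and slack e for each e distinct from
    i0 and d. *)
Lemma odd_extensions_slack (i0 : I) : 1 < #|I| ->
  odd #|extensions (slack @: [set~ i0])|.
Proof.
move=> I_gt1; set S := slack @: _.
have cardS : #|S|.+1 = #|I| by apply: card_slack_facet.
have domS : dominant S by apply: dominant_slack.
have slackS e : (slack e \in S) = (e != i0).
  by rewrite mem_imset ?inE //; apply: slack_inj.
have [|mu [mu_in mu_min]] := @minima_exist S.
  by rewrite -card_gt0; move: I_gt1; rewrite -cardS.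
have mu_slack e : e != i0 -> mu e = slack e.
  move=> ei; apply: (@rk_inj e); apply/eqP.
  by rewrite eqn_leq slack_min mu_min // slackS.
have [i [j [ij muij iN jN ->]]] := extensionsE mu_in mu_min domS cardS.
have up : above mu i0 != set0.
  apply/set0Pn; exists t0; apply/aboveP => e ei.
  by rewrite mu_slack //; apply: slack_lt.
have down d : d != i0 -> mu i0 = mu d -> [disjoint above mu d & S] ->
    above mu d = set0.
  move=> di mud dN; apply/setP => y; rewrite [RHS]inE; apply/negP => yA.
  have yi : rk i0 (slack d) < rk i0 y.
    by rewrite -(mu_slack _ di) -mud; move/aboveP: yA; apply; rewrite eq_sym.
  have [/codomP[g yg]|/slack_big] := boolP (y \in codom slack); last first.
    by move=> /(_ i0 d di); rewrite ltnNge (ltnW yi).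
  have [gi|gi] := eqVneq g i0.
    by move: yi; rewrite yg gi ltnNge slack_min.
  by have /pred0P/(_ y) := dN; rewrite /= yA yg slackS gi.
rewrite !card_highest.
have [ii|ii] := eqVneq i i0.
  by subst i; rewrite up (down j) ?eqxx // eq_sym.
have [jj|jj] := eqVneq j i0.
  by subst j; rewrite up (down i) ?eqxx.
by move: ij; rewrite (@slack_inj i j) ?eqxx // -!mu_slack.
Qed.

Context (c : V -> I) (c_slack : forall i, c (slack i) = i).

Definition almost_rainbow (i0 : I) (S : {set V}) :=
  [&& dominant S, #|S|.+1 == #|I| & c @: S == [set~ i0]].

(** Since slack i has colour i, the only boundary face among the almost rainbow
    sets is the one that lacks slack i0. *)
Lemma odd_sum_extensions i0 : 1 < #|I| ->
  odd (\sum_(S : {set V} | almost_rainbow i0 S) #|extensions S|).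
Proof.
move=> I_gt1; rewrite (bigD1 (slack @: [set~ i0])) /=; last first.
  rewrite /almost_rainbow dominant_slack // card_slack_facet eqxx /=.
  rewrite -imset_comp; apply/eqP; rewrite -[RHS]imset_id.
  by apply: eq_imset => i /=.
rewrite oddD odd_extensions_slack //= (big_morph odd oddD (erefl _)).
rewrite big1 // => S /andP[/and3P[domS /eqP cardS /eqP cS] SN].
apply/negbTE; suff [v vS vN] : exists2 v, v \in S & v \notin codom slack.
  exact: even_extensions vS vN.
apply/exists_inP; apply: contraNT SN => /exists_inPn allS.
apply/eqP/setP => x; apply/idP/imsetP => [xS|[j + ->]].
  have /codomP[j xj] : x \in codom slack by have := allS x xS; rewrite negbK.
  exists j => //; rewrite -cS -[j]c_slack -xj; exact: imset_f.
rewrite -cS => /imsetP[y yS ->].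
by have := allS y yS; rewrite negbK => /codomP[k yk]; rewrite yk c_slack -yk.
Qed.

(** If S :\ x is almost rainbow and S does not carry all colours, then x repeats
    the colour of a unique other vertex y, and x and y are the two vertices
    whose removal leaves an almost rainbow set. *)
Lemma even_facets i0 (S : {set V}) :
  dominant S -> c @: S != [set: I] -> #|S| = #|I| ->
  ~~ odd #|[set x in S | almost_rainbow i0 (S :\ x)]|.
Proof.
move=> domS cS cardS; set D := [set x in S | _].
case: (set_0Vmem D) => [->|[x]]; first by rewrite cards0.
rewrite inE => /andP[xS /and3P[domx _ /eqP cx]].
have inj : {in S :\ x &, injective c}.
  apply/imset_injP; apply/eqP; rewrite cx cardsC1 -cardS.
  by rewrite (cardsD1 x S) xS.
have cxi : c x != i0.
  apply: contraNneq cS => cxi; apply/eqP/setP => i; rewrite inE.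
  have [->|ii] := eqVneq i i0; first by rewrite -cxi imset_f.
  have : i \in c @: (S :\ x) by rewrite cx !inE.
  by move/imsetP => [y]; rewrite inE => /andP[_ yS] ->; apply: imset_f.
have /imsetP[y yS cxy] : c x \in c @: (S :\ x) by rewrite cx !inE.
have [yx yS'] : y != x /\ y \in S by move: yS; rewrite !inE => /andP[].
have cI i : i != i0 -> i \in c @: (S :\ y).
  move=> ii.
  have : i \in c @: (S :\ x) by rewrite cx !inE.
  case/imsetP => z; rewrite !inE => /andP[zx zS] ->.
  have [->|zy] := eqVneq z y; last by rewrite imset_f // !inE zy.
  by rewrite -cxy imset_f // !inE eq_sym yx.
have -> : D = [set x; y].
  apply/setP => z; rewrite !inE; apply/andP/orP => [[zS /and3P[_ _ /eqP cz]]|].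
    have [->|zx] := eqVneq z x; [by left | right].
    have zSx : z \in S :\ x by rewrite !inE zx.
    have : c z \in c @: (S :\ z) by rewrite cz -cx imset_f.
    case/imsetP => w; rewrite !inE => /andP[wz wS] czw.
    have [wx|wx] := eqVneq w x.
      by apply/eqP; apply: inj => //; rewrite czw wx.
    by move: wz; rewrite (inj z w) ?eqxx // !inE wx.
  case=> /eqP ->.
    split=> //.
    by rewrite /almost_rainbow domx cx -cardS (cardsD1 x S) xS !eqxx.
  split=> //; apply/and3P; split; first exact: dominantS (subsetDl _ _) domS.
    by rewrite -cardS (cardsD1 y S) yS' eqxx.
  apply/eqP/setP => i; rewrite [RHS]inE in_set1.
  apply/idP/idP => [/imsetP[w]|/cI //].
  rewrite !inE => /andP[_ wS] ->.
  have [->|wx] := eqVneq w x; first exact: cxi.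
  have : c w \in [set~ i0] by rewrite -cx imset_f // !inE wx.
  by rewrite !inE.
by rewrite cards2 eq_sym yx.
Qed.

(** Both sides count the pairs of a facet S and a vertex x of S such that S :\ x
    is almost rainbow. *)
Lemma sum_extensions_facets i0 :
  \sum_(S : {set V} | almost_rainbow i0 S) #|extensions S| =
  \sum_(S : {set V} | dominant S && (#|S| == #|I|))
     #|[set x in S | almost_rainbow i0 (S :\ x)]|.
Proof.
transitivity (\sum_(S : {set V}) \sum_(x : V)
    (almost_rainbow i0 S && (x \in extensions S) : nat)).
  rewrite big_mkcond; apply: eq_bigr => S _; rewrite -sum1_card.
  case: almost_rainbow => /=; last by rewrite big1.
  by rewrite big_mkcond; apply: eq_bigr => x _; case: (x \in _).
transitivity (\sum_(S : {set V}) \sum_(x : V) ([&& dominant S, #|S| == #|I|,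
    x \in S & almost_rainbow i0 (S :\ x)] : nat)); last first.
  rewrite [RHS]big_mkcond; apply: eq_bigr => S _.
  case: (dominant S) => /=; last by rewrite big1.
  case: (#|S| == #|I|) => /=; last by rewrite big1.
  rewrite -sum1_card [RHS]big_mkcond.
  by apply: eq_bigr => x _; rewrite inE; case: (x \in S); case: almost_rainbow.
rewrite exchange_big [RHS]exchange_big /=; apply: eq_bigr => x _.
rewrite [LHS](bigID (fun S : {set V} => x \in S)) /= big1 ?add0n; last first.
  by move=> S xS; rewrite inE xS andbF.
rewrite [RHS](bigID (fun S : {set V} => x \in S)) /=.
rewrite [X in _ = _ + X]big1 ?addn0.
  rewrite [RHS](reindex_onto (fun S => x |: S) (fun S => S :\ x)) /=;
    last by move=> S; apply: setD1K.
  apply: eq_big => [S|S xS].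
    rewrite !inE eqxx /=; apply/idP/eqP => [xS|<-]; last by rewrite !inE eqxx.
    exact: setU1K.
  rewrite setU1K // /almost_rainbow !inE eqxx xS cardsU1 xS add1n /=.
  case: (dominant (x |: S)); rewrite ?andbF //= andbT.
  by case: (_ == _); rewrite ?andbF.
by move=> S /negbTE ->; rewrite !andbF.
Qed.

(** If no facet carried all colours, [even_facets] would make the right-hand
    side of [sum_extensions_facets] even, against [odd_sum_extensions]. *)
Theorem rainbow_dominant : 1 < #|I| ->
  exists2 S, dominant S & c @: S = [set: I].
Proof.
move=> I_gt1; have /card_gt0P[i0 _] : 0 < #|I| by apply: ltnW.
have := odd_sum_extensions i0 I_gt1; rewrite sum_extensions_facets => h.
suff /exists_inP[S domS /eqP cS] : [exists S in dominant, c @: S == [set: I]].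
  by exists S.
apply: contraTT h => /exists_inPn h.
rewrite (big_morph odd oddD (erefl _)) big1 // => S /andP[domS /eqP cardS].
by apply/negbTE/even_facets => //; apply: h.
Qed.

End Scarf.

(** * Rainbow sets of grid points of the simplex *)

Section Grid.
Context {I : finType} (k : nat).
Implicit Types a b : {ffun I -> 'I_k.+1}.

Let on_grid a := \sum_i a i == k.
Let T : finType := {a | on_grid a}.

(* Grid points are ordered by their i-th coordinate, ties being broken by the
   enumeration of T. *)
Let rk (i : I) (v : T + I) : nat :=
  match v with
  | inl t => (val t i * #|T| + enum_rank t).+1
  | inr j => if j == i then 0 else (k.+1 * #|T| + enum_rank j).+1
  end.

Let rk_bound i (t : T) : val t i * #|T| + enum_rank t < k.+1 * #|T|.
Proof.
apply: (@leq_trans ((val t i).+1 * #|T|)); last first.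
  by rewrite leq_mul2r ltn_ord orbT.
by rewrite mulSn addnC ltn_add2r.
Qed.

Let rk_le i (s t : T) : rk i (inl s) <= rk i (inl t) -> val s i <= val t i.
Proof.
apply: contraTT; rewrite -!ltnNge /= ltnS => lt_ts.
apply: (@leq_trans ((val t i).+1 * #|T|)).
  by rewrite mulSn addnC ltn_add2r.
by apply: leq_trans (leq_addr _ _); rewrite leq_mul2r lt_ts orbT.
Qed.

Let rk_inj i : injective (rk i).
Proof.
move=> [s|j] [t|l] /= h.
- have := rk_le (i := i) (s := s) (t := t).
  have := rk_le (i := i) (s := t) (t := s).
  rewrite /= h leqnn => /(_ isT) h1 /(_ isT) h2.
  have e : val s i = val t i :> nat by apply/eqP; rewrite eqn_leq h1 h2.
  move: h; rewrite e => -[/addnI/val_inj/enum_rank_inj ->] //.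
- case: (l == i) h => // -[h]; have := rk_bound i s.
  by rewrite h ltnNge leq_addr.
- case: (j == i) h => // -[h]; have := rk_bound i t.
  by rewrite -h ltnNge leq_addr.
- case: (eqVneq j i) h => [->|_]; case: (eqVneq l i) => [->|_] //.
  by case=> /addnI/val_inj/enum_rank_inj ->.
Qed.

(** Let D consist of the grid points of a rainbow dominant set, C of the colours
    whose slack vertex is absent from it, and m i be the minimum over D of the
    i-th coordinate.  The colours in C are carried by D.  By dominance no grid
    point exceeds m i in all coordinates i in C, so the m i, i in C, add up to
    more than k - #|C|.  As the coordinates of a grid point add up to k, those
    in C are close to m i and those outside C are close to 0. *)
Lemma small_rainbow (c : {ffun I -> 'I_k.+1} -> I) : 1 < #|I| ->
  exists D : {set {ffun I -> 'I_k.+1}},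
    [/\ D != set0,
        forall a, a \in D -> \sum_i a i = k,
        forall a b i, a \in D -> b \in D -> a i <= b i + #|I| &
        forall a i, a \in D -> #|I| < a i -> exists2 b, b \in D & c b = i].
Proof.
move=> I_gt1; have /card_gt0P[i0 _] : 0 < #|I| by apply: ltnW.
have slackP (v : T + I) : v \notin codom inr -> exists t, v = inl t.
  case: v => [t|j]; first by exists t.
  by rewrite codom_f.
have vertex_sum (i : I) :
    \sum_j [ffun j => if j == i then (@ord_max k) else ord0] j == k.
  rewrite (bigD1 i) //= ffunE eqxx big1 ?addn0 // => j ji.
  by rewrite ffunE (negbTE ji).
pose t0 : T := exist on_grid _ (vertex_sum i0).
have t0N : (inl t0 : T + I) \notin codom inr by apply/codomP => -[].
pose color (v : T + I) := match v with inl t => c (val t) | inr i => i end.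
have [||S domS cS] :=
  @rainbow_dominant _ _ rk inr rk_inj _ _ _ t0N color (fun=> erefl) I_gt1.
- by move=> i v /=; rewrite eqxx.
- move=> i j v ji /slackP[t ->] /=; rewrite (negbTE ji) ltnS.
  exact: leq_trans (rk_bound i t) (leq_addr _ _).
pose C : {set I} := [set i | inr i \notin S].
pose D := [set val t | t : T & inl t \in S].
(* The order that dominates a grid point t is not that of a slack vertex of S,
   which would lie below t. *)
have domD (t : T) :
    exists2 i, i \in C & forall s, inl s \in S -> val t i <= val s i.
  have /dominantP/(_ (inl t))[i hi] := domS; exists i.
    by rewrite inE; apply/negP => /hi; rewrite /= eqxx.
  by move=> s /hi; apply: rk_le.
have hit i : i \in C -> exists2 s : T, inl s \in S & c (val s) = i.
  move=> iC; have : i \in color @: S by rewrite cS.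
  case/imsetP => -[s|j] vS iE; first by exists s.
  by move: iC; rewrite iE inE /= vS.
have [i1 i1C _] := domD t0.
have [s1 s1S _] := hit _ i1C.
pose m i := val [arg min_(s < s1 | inl s \in S) val s i] i : nat.
have m_le i s : inl s \in S -> m i <= val s i.
  by rewrite /m; case: arg_minnP => // t _ h sS; apply: h.
have m_domD (t : T) : exists2 i, i \in C & val t i <= m i.
  have [i iC h] := domD t; exists i => //.
  by rewrite /m; case: arg_minnP => // s sS _; apply: h.
have sum_m : k < \sum_(i in C) (m i).+1.
  rewrite ltnNge; apply/negP => le_k.
  (* Otherwise add 1 to each m i and put the excess d on the coordinate i1: this
     is a grid point that contradicts m_domD. *)
  pose d := k - \sum_(i in C) (m i).+1.
  pose f i := if i \in C then (m i).+1 + (if i == i1 then d else 0) else 0.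
  have sum_f : \sum_i f i = k.
    rewrite (bigID (mem C)) /= [X in _ + X]big1 ?addn0; last first.
      by move=> i /negbTE iC; rewrite /f iC.
    transitivity (\sum_(i in C) ((m i).+1 + (if i == i1 then d else 0))).
      by apply: eq_bigr => i iC; rewrite /f iC.
    rewrite big_split /= -big_mkcondr /=.
    rewrite [X in _ + X](big_pred1 i1) ?subnKC // => i /=.
    by case: (eqVneq i i1) => [->|_]; rewrite ?andbT ?andbF.
  have f_le i : f i < k.+1.
    by rewrite ltnS -[leqRHS]sum_f (bigD1 i) //= leq_addr.
  have sum_ff : \sum_i [ffun i => Ordinal (f_le i)] i == k.
    by rewrite -[X in _ == X]sum_f; apply/eqP/eq_bigr => i _; rewrite ffunE.
  have [i iC] := m_domD (exist on_grid _ sum_ff).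
  by rewrite /= ffunE /= /f iC addSn ltnNge leq_addr.
have split_sum (s : T) : inl s \in S ->
    \sum_(i in C) (val s i - m i) + \sum_(i | i \notin C) val s i < #|I|.
  move=> sS; have /eqP := valP s; rewrite (bigID (mem C)) /=.
  have -> : \sum_(i in C) val s i =
      \sum_(i in C) (val s i - m i) + \sum_(i in C) m i.
    by rewrite -big_split; apply: eq_bigr => i _ /=; rewrite subnK // m_le.
  move: sum_m; under eq_bigr do rewrite -addn1.
  rewrite big_split /= sum1_card; have : #|C| <= #|I| by apply: max_card.
  move: #|C| #|I| (\sum_(i in C) (sval s i - m i)) (\sum_(i in C) m i)
    (\sum_(i | i \notin C) sval s i).
  lia.
have in_C i (s : T) : i \in C -> inl s \in S -> val s i <= m i + #|I|.
  move=> iC sS; have := split_sum _ sS; rewrite (bigD1 i) //=.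
  by have := m_le i s sS; lia.
have out_C i (s : T) : i \notin C -> inl s \in S -> val s i <= #|I|.
  move=> iC sS; have := split_sum _ sS.
  by rewrite [X in _ + X](bigD1 i) //=; lia.
exists D; split.
- by apply/set0Pn; exists (val s1); apply/imsetP; exists s1; rewrite ?inE.
- by move=> a /imsetP[s _ ->]; apply/eqP; exact: (valP s).
- move=> a b i /imsetP[s + ->] /imsetP[t + ->]; rewrite !inE => sS tS.
  have [iC|iC] := boolP (i \in C).
    by apply: leq_trans (in_C _ _ iC sS) _; rewrite leq_add2r m_le.
  exact: leq_trans (out_C _ _ iC sS) (leq_addl _ _).
- move=> a i /imsetP[s + ->]; rewrite inE => sS lt_i.
  have [iC|iC] := boolP (i \in C); last first.
    by move: lt_i; rewrite ltnNge out_C.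
  have [t tS <-] := hit i iC; exists (val t) => //.
  by apply/imsetP; exists t; rewrite ?inE.
Qed.

End Grid.

From mathcomp Require Import all_classical all_reals all_analysis.
Import Order.TTheory GRing.Theory Num.Theory.
Import numFieldNormedType.Exports.
Local Open Scope classical_set_scope.
Local Open Scope ring_scope.

(** * Weights supported by their best responses *)

Section Weights.
Context {R : realType} {n : nat}.
Implicit Types u v w : 'rV[R]_n.

Definition weights : set 'rV[R]_n :=
  [set w | (forall i, 0 <= w ord0 i) /\ \sum_i w ord0 i = 1].

Lemma rV_norm_le v e : 0 <= e -> (forall i, `|v ord0 i| <= e) -> `|v| <= e.
Proof.
move=> e0 ve; rewrite [leLHS]/Num.norm/= mx_normrE.
by apply: bigmax_le => // -[i j] _ /=; rewrite ord1.
Qed.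

Lemma weights_le1 w i : weights w -> w ord0 i <= 1.
Proof.
by case=> w0 w1; rewrite -w1 (bigD1 i) //= lerDl sumr_ge0.
Qed.

Lemma compact_weights : compact weights.
Proof.
apply: bounded_closed_compact.
  exists 1; split; first exact: num_real.
  move=> M M1 w /= ww; apply: rV_norm_le; first exact: le_trans (ltW M1).
  move=> i; rewrite ger0_norm ?(weights_le1 _ ww) //; last by case: ww.
  exact: le_trans (weights_le1 _ ww) (ltW M1).
have -> : weights = (\bigcap_(i in [set: 'I_n]) [set w | 0 <= w ord0 i])
                    `&` [set w | \sum_i w ord0 i = 1].
  apply/seteqP; split=> w [h1 h2]; split=> // i; first by move=> _; apply: h1.
  exact: h1.
apply: closedI.
  apply: closed_bigI => i _.
  apply: (@closed_comp _ _ (fun w => w ord0 i) [set x | 0 <= x]).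
    by move=> w _; apply: coord_continuous.
  exact: closed_ge.
apply: (@closed_comp _ _ (fun w => \sum_i w ord0 i) [set x | x = 1]).
  move=> w _; apply: continuous_big; first exact: add_continuous.
  by move=> i _; exact: coord_continuous.
exact: closed_eq.
Qed.

End Weights.

(** At a cluster point w of the approximate solutions u k, every index i in the
    support of w is, for infinitely many k, the colour of a point v at distance
    at most mesh k from u k, hence close to w; so h i v <= h j v passes to the
    limit. *)
Theorem best_response_weights {R : realType} {m : nat}
    (h : 'I_m.+2 -> 'rV[R]_m.+2 -> R) : (forall i, continuous (h i)) ->
  exists2 w, weights w &
    forall i j, 0 < w ord0 i -> h i w <= h j w.
Proof.
move=> hcont; pose n := m.+2; pose mesh k : R := n%:R / k.+1%:R.
have approx k : exists u : 'rV[R]_n, weights u /\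
    forall i, mesh k < u ord0 i ->
      exists2 v, `|u - v| <= mesh k & forall j, h i v <= h j v.
  pose pt (a : {ffun 'I_n -> 'I_k.+2}) : 'rV[R]_n :=
    \row_i ((a i)%:R / k.+1%:R).
  pose c a := [arg min_(i < ord0) h i (pt a)]%O.
  have [|D [D0 sumD closeD hitD]] := @small_rainbow _ k.+1 c.
    by rewrite card_ord.
  have /finset.set0Pn[a aD] := D0; exists (pt a); split.
    split=> [i|]; first by rewrite mxE divr_ge0.
    under eq_bigr do rewrite mxE.
    by rewrite -mulr_suml -natr_sum sumD // divff.
  move=> i; rewrite mxE /mesh ltr_pM2r ?invr_gt0 // ltr_nat => ai.
  have [|b bD cb] := hitD a i aD; first by rewrite card_ord.
  exists (pt b); last first.
    move=> j; rewrite -cb /c.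
    by case: Order.TotalTheory.arg_minP => // l _; apply.
  apply: rV_norm_le => [|j]; first by rewrite divr_ge0.
  rewrite !mxE -mulrBl normrM [X in _ * X]ger0_norm ?invr_ge0 //.
  rewrite ler_pM2r ?invr_gt0 // ler_norml; apply/andP; split.
    rewrite lerNl opprB lerBlDl -natrD ler_nat.
    by have := closeD b a j bD aD; rewrite card_ord.
  rewrite lerBlDl -natrD ler_nat.
  by have := closeD a b j aD bD; rewrite card_ord.
have [u hu] := choice approx.
have [|w [ww clw]] := compact_weights (n := n) (F := u @ \oo).
  by exists 0%N => // k _ /=; case: (hu k).
exists w => // i j wi; rewrite leNgt; apply/negP => hji.
have [e /= e0 he] : exists2 e : R, 0 < e & forall v, `|w - v| < e ->
    h j v < h i v /\ w ord0 i / 2 < v ord0 i.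
  have : \forall v \near w, h j v < h i v /\ w ord0 i / 2 < v ord0 i.
    have : h i v - h j v @[v --> w] --> h i w - h j w.
      exact: (cvgB (hcont i w) (hcont j w)).
    move/cvgr_gt => /(_ 0); rewrite subr_gt0 => /(_ hji) near1.
    have /cvgr_gt/(_ (w ord0 i / 2)) near2 : v ord0 i @[v --> w] --> w ord0 i.
      exact: coord_continuous.
    near=> v; split; first by rewrite -subr_gt0; near: v.
    near: v; apply: near2; lra.
  case/nbhs_ballP => e /= e0 he; exists e => // v wv; apply: he.
  by rewrite -ball_normE.
pose d := Num.min (e / 2) (w ord0 i / 2).
have d0 : 0 < d by rewrite lt_min; apply/andP; split; lra.
have [K _ meshK] : exists2 K, True & forall k, (K <= k)%N -> mesh k < d.
  exists (Num.trunc (n%:R / d)) => // k Kk.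
  rewrite /mesh ltr_pdivrMr // mulrC -ltr_pdivrMr //.
  by apply: lt_le_trans (truncnS_gt _) _; rewrite ler_nat.
have [_ [[k Kk <-] wu]] : u @` [set k | (K <= k)%N] `&` ball w (e / 2) !=set0.
  apply: clw; last by apply: nbhsx_ballx; lra.
  by exists K => // k Kk /=; exists k.
have {}wu : `|w - u k| < e / 2 by move: wu; rewrite -ball_normE.
have := meshK _ Kk; rewrite lt_min => /andP[me mw].
have [_ uki] : h j (u k) < h i (u k) /\ w ord0 i / 2 < u k ord0 i.
  by apply: he; lra.
have [_ /(_ i (lt_trans mw uki))[v uv hv]] := hu k.
have [] : h j v < h i v /\ w ord0 i / 2 < v ord0 i; last by rewrite ltNge hv.
apply: he; rewrite -(subrKA (u k)); apply: le_lt_trans (ler_normD _ _) _; lra.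
Unshelve. all: by end_near. Qed.

(** * The space of profiles as a topological vector space *)

Section ProfileTopology.
Context {R : realType} {N : finType} {n : N -> nat}.
Local Notation V := (profile R n).

Lemma profile_proj_continuous nu : continuous (fun x : V => x nu).
Proof. exact: (@proj_continuous N (fun nu => 'rV[R]_(n nu)) nu). Qed.

Lemma profile_cvg (F : set_system V) (x : V) : Filter F ->
  (forall nu, y nu @[y --> F] --> x nu) -> F --> x.
Proof.
move=> FF cv; apply/cvg_sup => nu.
have surj : [set f nu | f in [set: V]] = [set: 'rV[R]_(n nu)].
  apply/seteqP; split=> // z _; exists (unilateral x nu z) => //.
  by rewrite /unilateral dfwithin.
apply/(cvg_image _ _ surj) => U /cv FU; exists [set y : V | U (y nu)] => //.
by rewrite image_preimage.
Qed.

Lemma profile_continuous (T : topologicalType) (f : T -> V) :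
  (forall nu, continuous (fun t => f t nu)) -> continuous f.
Proof.
by move=> cf t; apply: profile_cvg => nu; apply: cf.
Qed.

Fact profile_add_continuous : continuous (fun x : V * V => x.1 + x.2).
Proof.
apply: profile_continuous => nu [x y] /=.
apply: cvgD.
  apply: (cvg_comp fst (fun v : V => v nu)); first exact: cvg_fst.
  exact: profile_proj_continuous.
apply: (cvg_comp snd (fun v : V => v nu)); first exact: cvg_snd.
exact: profile_proj_continuous.
Qed.

Fact profile_scale_continuous : continuous (fun z : R^o * V => z.1 *: z.2).
Proof.
apply: profile_continuous => nu [a x] /=.
apply: cvgZ; first exact: cvg_fst.
apply: (cvg_comp snd (fun v : V => v nu)); first exact: cvg_snd.
exact: profile_proj_continuous.
Qed.

HB.instance Definition _ :=
  PreTopologicalNmodule_isTopologicalNmodule.Build V profile_add_continuous.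
HB.instance Definition _ :=
  TopologicalNmodule_isTopologicalLmodule.Build R V profile_scale_continuous.

Lemma unilateral_continuous nu (z : 'rV[R]_(n nu)) :
  continuous (fun x : V => unilateral x nu z).
Proof.
apply: profile_continuous => mu; have [<-|numu] := eqVneq nu mu.
  have -> : (fun x : V => unilateral x nu z nu) = cst z.
    by apply/funext => x; rewrite /unilateral dfwithin.
  exact: cst_continuous.
have -> : (fun x : V => unilateral x nu z mu) = (fun x : V => x mu).
  by apply/funext => x; rewrite /unilateral dfwithout.
exact: profile_proj_continuous.
Qed.

End ProfileTopology.

(** * Ky Fan's inequality *)

Section Convexity.
Context {R : realType}.

Lemma convex_setP (E : lmodType R) (A : set E) :
  convex_set A <-> (forall x y (t : R), A x -> A y -> 0 <= t -> t <= 1 ->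
                     A (t *: x + (1 - t) *: y)).
Proof.
split=> [cA x y t Ax Ay t0 t1|cA x y t].
  by have := cA x y (Itv01 t0 t1); rewrite !inE => /(_ Ax Ay).
by rewrite !inE => Ax Ay; apply: cA.
Qed.

(** The induction renormalizes partial sums to total weight 1, as long as their
    weights do not all vanish. *)
Lemma convex_set_sum (E : lmodType R) (A : set E) n (w : 'rV[R]_n)
    (y : 'I_n -> E) : convex_set A -> weights w ->
  (forall i, 0 < w ord0 i -> A (y i)) -> A (\sum_i w ord0 i *: y i).
Proof.
move=> cA [w0 w1] Ay.
pose S (r : seq 'I_n) := \sum_(i <- r) w ord0 i.
suff main (r : seq 'I_n) : let v := \sum_(i <- r) w ord0 i *: y i in
    (S r = 0 /\ v = 0) \/ (0 < S r /\ A ((S r)^-1 *: v)).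
  have [[]|[_]] := main (index_enum 'I_n); rewrite /S w1.
    by move/eqP; rewrite oner_eq0.
  by rewrite invr1 scale1r.
elim: r => [|i r IHr] /=; first by left; rewrite /S !big_nil.
rewrite /S !big_cons -/(S r).
have := w0 i; rewrite le_eqVlt => /predU1P[<-|wi].
  by rewrite scale0r !add0r.
right; case: IHr => [[-> ->]|[Sr Ar]].
  by rewrite !addr0 scalerA mulVf ?gt_eqF // scale1r; split=> //; apply: Ay.
have pos : 0 < w ord0 i + S r by apply: addr_gt0.
split=> //; set t := w ord0 i / (w ord0 i + S r).
have t1 : 1 - t = S r / (w ord0 i + S r).
  by apply/eqP; rewrite subr_eq /t -mulrDl [S r + _]addrC divff ?eqxx ?gt_eqF.
have := (convex_setP A).1 cA _ _ t (Ay i wi) Ar.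
rewrite t1 scalerA [S r / _ / _]mulrAC divff ?gt_eqF // mul1r.
rewrite scalerDr scalerA [_^-1 * w _ _]mulrC; apply.
  by rewrite divr_ge0 ?ltW.
by rewrite ler_pdivrMr // mul1r lerDl ltW.
Qed.

End Convexity.

(** Compactness reduces the claim to finitely many y.  The convexity hypothesis
    is quasi-convexity of Psi x at level 0: together with Psi x x >= 0 it forbids
    that Psi x be negative at all the points of which x is a barycenter. *)
Theorem ky_fan {R : realType} (E : topologicalLmodType R) (K : set E)
    (Psi : E -> E -> R) :
  K !=set0 -> compact K -> convex_set K ->
  (forall y, continuous (Psi^~ y)) ->
  (forall x, K x -> convex_set [set y | K y /\ Psi x y < 0]) ->
  (forall x, K x -> 0 <= Psi x x) ->
  exists2 x, K x & forall y, K y -> 0 <= Psi x y.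
Proof.
move=> [y0 Ky0] cK convK contPsi convPsi diagPsi.
have fin (s : seq E) : (forall y, y \in s -> K y) ->
    exists2 x, K x & forall y, y \in s -> 0 <= Psi x y.
  (* [best_response_weights] is stated for at least two indices: s is padded
     with copies of y0. *)
  move=> sK; pose m := size s; pose y (i : 'I_m.+2) := nth y0 s i.
  have Ky i : K (y i).
    have [lt_is|le_si] := ltnP i m; first by apply/sK/mem_nth.
    by rewrite /y nth_default.
  pose bary (w : 'rV[R]_m.+2) := \sum_i w ord0 i *: y i.
  have bary_cont : continuous bary.
    apply: continuous_big; first exact: add_continuous.
    move=> i _ w.
    apply: (@continuous2_cvg _ R^o E E (nbhs w) _ _ _
      (fun a v => a *: v) (w ord0 i) (y i)).
    - exact: (scale_continuous (w ord0 i : R^o, y i)).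
    - exact: coord_continuous.
    - exact: cvg_cst.
  have [|w ww wmin] :=
    @best_response_weights R m (fun i w => Psi (bary w) (y i)).
    by move=> i w; apply: (cvg_comp bary (Psi^~ (y i)));
      [exact: bary_cont|exact: contPsi].
  have Kw : K (bary w) by apply: convex_set_sum.
  exists (bary w) => // z /(nthP y0)[k ks <-]; rewrite leNgt; apply/negP => neg.
  have km : (k < m.+2)%N by rewrite (leq_trans ks) // !leqW.
  have : [set y | K y /\ Psi (bary w) y < 0] (bary w).
    apply: convex_set_sum => // [|i wi /=]; first exact: convPsi.
    by split=> //; apply: le_lt_trans (wmin i (Ordinal km) wi) neg.
  by case=> _; rewrite ltNge diagPsi.
pose F y := K `&` [set x | 0 <= Psi x y].
have finF : finI K F.
  move=> D DK; have [|x Kx xD] := fin (y0 :: finmap.enum_fset D).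
    by move=> y; rewrite inE => /predU1P[->//|yD]; apply/set_mem/DK.
  by exists x => y yD; split=> //; apply: xD; rewrite inE yD orbT.
have [|x [Kx clx]] := cK _ (finI_filter finF).
  by exists (F y0); [exact: finI_from1|move=> z []].
exists x => // y Ky.
have : closed [set x | 0 <= Psi x y].
  apply: (@closed_comp _ _ (Psi^~ y) [set r | 0 <= r]); last exact: closed_ge.
  by move=> z _; apply: contPsi.
apply=> B; apply: clx; exists (F y); first exact: finI_from1.
by move=> z [].
Qed.

(** * Compactness of the balls of an arbitrary norm *)

Section Norms.
Context {R : realType} {N : finType} {n : N -> nat}.
Local Notation V := (profile R n).
Implicit Types x y : V.

Lemma profile_sumE (I : Type) (r : seq I) (f : I -> V) nu :
  (\sum_(i <- r) f i) nu = \sum_(i <- r) f i nu.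
Proof.
by elim: r => [|i r IHr]; rewrite ?big_nil // !big_cons -IHr.
Qed.

Lemma unilateral_id x nu : unilateral x nu (x nu) = x.
Proof.
apply: functional_extensionality_dep => mu; rewrite /unilateral.
by have [<-|h] := eqVneq nu mu; rewrite ?dfwithin ?dfwithout.
Qed.

Definition basis_profile nu (j : 'I_(n nu)) : V :=
  unilateral (0 : V) nu (delta_mx 0 j).

Lemma profile_decomposition x :
  x = \sum_nu \sum_(j < n nu) x nu 0 j *: basis_profile j.
Proof.
apply: functional_extensionality_dep => mu; rewrite profile_sumE.
rewrite (bigD1 mu) //= [X in _ + X]big1 => [|nu numu].
  rewrite addr0 profile_sumE [LHS]row_sum_delta; apply: eq_bigr => j _.
  by rewrite /GRing.scale /= /profile_scale /basis_profile /unilateral dfwithin.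
rewrite profile_sumE big1 // => j _.
rewrite /GRing.scale /= /profile_scale /basis_profile /unilateral dfwithout //.
exact: scaler0.
Qed.

Definition sum_norm x : R := \sum_nu `|x nu|.

Lemma sum_norm_continuous : continuous sum_norm.
Proof.
apply: continuous_big; first exact: add_continuous.
move=> nu _ x; exact: (cvg_norm (@profile_proj_continuous R N n nu x)).
Qed.

Lemma sum_norm_scale a x : sum_norm (a *: x) = `|a| * sum_norm x.
Proof.
by rewrite /sum_norm mulr_sumr; apply: eq_bigr => nu _; rewrite -normrZ.
Qed.

Lemma sum_norm_ge x nu : `|x nu| <= sum_norm x.
Proof. by rewrite /sum_norm (bigD1 nu) //= lerDl sumr_ge0. Qed.

Lemma sum_norm_ge0 x : 0 <= sum_norm x.
Proof. exact: sumr_ge0. Qed.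

Lemma sum_norm_eq0 x : sum_norm x = 0 -> x = 0.
Proof.
move=> x0; apply: functional_extensionality_dep => nu; apply/eqP.
by rewrite -normr_le0 -x0 sum_norm_ge.
Qed.

Lemma compact_box r : compact [set x : V | forall nu, `|x nu| <= r].
Proof.
apply: (@tychonoff N (fun nu => 'rV[R]_(n nu)) (fun nu => [set z | `|z| <= r])).
move=> nu; apply: bounded_closed_compact.
  exists r; split; first exact: num_real.
  by move=> M rM z /= zr; apply: le_trans zr (ltW rM).
apply: (@closed_comp _ _ (fun z : 'rV[R]_(n nu) => `|z|) [set s | s <= r]);
  last exact: closed_le.
by move=> z _; exact: norm_continuous.
Qed.

Context (nrm : V -> R) (nrmP : is_norm nrm).

Let nrmD x y : nrm (x + y) <= nrm x + nrm y. Proof. by case: nrmP. Qed.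
Let nrmZ a x : nrm (a *: x) = `|a| * nrm x. Proof. by case: nrmP. Qed.
Let nrm_eq0 x : nrm x = 0 -> x = 0. Proof. by case: nrmP => _ _; apply. Qed.

Let nrm0 : nrm 0 = 0.
Proof. by rewrite -[0](scale0r (0 : V)) nrmZ normr0 mul0r. Qed.
Let nrmN x : nrm (- x) = nrm x.
Proof. by rewrite -scaleN1r nrmZ normrN1 mul1r. Qed.

Lemma nrm_ge0 x : 0 <= nrm x.
Proof. by have := nrmD x (- x); rewrite subrr nrm0 nrmN; lra. Qed.

Lemma nrm_convex x y t : 0 <= t -> t <= 1 ->
  nrm (t *: x + (1 - t) *: y) <= t * nrm x + (1 - t) * nrm y.
Proof.
move=> t0 t1; apply: le_trans (nrmD _ _) _.
by rewrite !nrmZ !ger0_norm // subr_ge0.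
Qed.

Lemma nrm_sum (I : Type) (r : seq I) (f : I -> V) :
  nrm (\sum_(i <- r) f i) <= \sum_(i <- r) nrm (f i).
Proof.
elim: r => [|i r IHr]; first by rewrite !big_nil nrm0.
by rewrite !big_cons; apply: le_trans (nrmD _ _) _; rewrite lerD2l.
Qed.

Lemma nrm_coord_bound x :
  nrm x <= \sum_nu \sum_(j < n nu) `|x nu 0 j| * nrm (basis_profile j).
Proof.
rewrite {1}[x]profile_decomposition.
apply: le_trans (nrm_sum _ _) _; apply: ler_sum => nu _.
apply: le_trans (nrm_sum _ _) _; apply: ler_sum => j _.
by rewrite nrmZ.
Qed.

Lemma nrm_dist x y : `|nrm x - nrm y| <= nrm (x - y).
Proof.
rewrite ler_norml; have := nrmD (x - y) y; have := nrmD (y - x) x.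
rewrite !subrK -(nrmN (y - x)) opprB; lra.
Qed.

Lemma nrm_continuous : continuous nrm.
Proof.
move=> x; apply/(@cvgrPdist_le _ _ _ _ (nbhs_filter x)) => e e0.
pose g y := \sum_nu \sum_(j < n nu) `|(x - y) nu 0 j| * nrm (basis_profile j).
have g_cont : continuous g.
  apply: continuous_big; first exact: add_continuous.
  move=> nu _; apply: continuous_big; first exact: add_continuous.
  move=> j _ y.
  have coord : (x - y') nu 0 j @[y' --> y] --> (x - y) nu 0 j.
    apply: (cvg_comp (fun y : V => (x - y) nu)
      (fun v : 'rV[R]_(n nu) => v 0 j)); last exact: coord_continuous.
    exact: (cvgB (cvg_cst (x nu)) (@profile_proj_continuous R N n nu y)).
  exact: (cvgM (cvg_norm coord) (cvg_cst _)).
have gx : g x = 0.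
  rewrite /g subrr big1 // => nu _; rewrite big1 // => j _.
  by rewrite mxE normr0 mul0r.
have : g y @[y --> x] --> 0 by rewrite -gx; apply: g_cont.
move/cvgrPdist_le => /(_ e e0); apply: filterS => y.
rewrite sub0r normrN; apply: le_trans.
apply: le_trans (nrm_dist _ _) _; apply: le_trans (nrm_coord_bound _) _.
exact: ler_norm.
Qed.

(** On the compact unit sphere of [sum_norm] the continuous function nrm has a
    minimum, which is positive; M is its inverse. *)
Lemma sum_norm_bound : exists M, forall x, sum_norm x <= M * nrm x.
Proof.
pose S := [set x : V | sum_norm x = 1].
have S_closed : closed S.
  apply: (@closed_comp _ _ sum_norm [set s | s = 1]); last exact: closed_eq.
  by move=> x _; apply: sum_norm_continuous.
have S_compact : compact S.
  apply: (subclosed_compact S_closed (@compact_box 1)) => x Sx nu.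
  by rewrite -Sx sum_norm_ge.
have normalize x : x != 0 -> S ((sum_norm x)^-1 *: x).
  move=> x0; have sx : sum_norm x != 0 by apply: contra_neq x0 => /sum_norm_eq0.
  by rewrite /S /= sum_norm_scale ger0_norm ?invr_ge0 ?sum_norm_ge0 // mulVf.
(* The sphere is empty when all strategy spaces have dimension 0. *)
have [S0|/set0P S0] := eqVneq S set0.
  exists 0 => x; have [->|/normalize] := eqVneq x 0; last by rewrite S0.
  by rewrite mul0r /sum_norm big1 // => nu _; rewrite normr0.
have [|c /set_mem Sc cmin] := compact_EVT_min S0 S_compact (f := nrm).
  exact/continuous_subspaceT/nrm_continuous.
have c0 : 0 < nrm c.
  rewrite lt_neqAle nrm_ge0 andbT eq_sym; apply/eqP => /nrm_eq0 c0.
  move: Sc; rewrite /S /= c0 /sum_norm big1 => [/eqP|nu _]; last exact: normr0.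
  by rewrite eq_sym oner_eq0.
exists (nrm c)^-1 => x; have [->|x0] := eqVneq x 0.
  by rewrite nrm0 mulr0 /sum_norm big1 // => nu _; rewrite normr0.
have sx : 0 < sum_norm x.
  rewrite lt_neqAle sum_norm_ge0 andbT eq_sym.
  by apply: contra_neq x0 => /sum_norm_eq0.
have /mem_set/cmin := normalize x x0.
rewrite nrmZ ger0_norm ?invr_ge0 ?sum_norm_ge0 //.
by rewrite ler_pdivlMl // mulrC -ler_pdivlMl.
Qed.

Lemma closed_norm_closed_ball r : closed (norm_closed_ball nrm r).
Proof.
apply: (@closed_comp _ _ nrm [set s | s <= r]); last exact: closed_le.
by move=> x _; apply: nrm_continuous.
Qed.

Lemma compact_norm_closed_ball r : compact (norm_closed_ball nrm r).
Proof.
have [M hM] := sum_norm_bound.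
apply: (subclosed_compact (@closed_norm_closed_ball r)
  (@compact_box (`|M| * r))) => x xr nu.
apply: le_trans (sum_norm_ge _ _) _; apply: le_trans (hM x) _.
apply: le_trans (ler_wpM2r (nrm_ge0 x) (ler_norm M)) _.
exact: ler_wpM2l.
Qed.

End Norms.

(** * The Nikaido-Isoda function *)

Section NikaidoIsoda.
Context {R : realType} {N : finType} {n : N -> nat}.
Local Notation V := (profile R n).
Context (theta : N -> V -> R).
Implicit Types x y z : V.

Definition nikaido_isoda x y : R :=
  \sum_nu (theta nu (unilateral x nu (y nu)) - theta nu x).

Lemma nikaido_isoda_continuous y : (forall nu, continuous (theta nu)) ->
  continuous (nikaido_isoda^~ y).
Proof.
move=> ctheta; rewrite /nikaido_isoda.
apply: continuous_big; first exact: add_continuous.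
move=> nu _ x; have := ctheta nu (unilateral x nu (y nu)).
move=> /(cvg_comp _ _ (@unilateral_continuous R N n nu (y nu) x)) cv.
exact: (@cvgB _ _ _ _ (nbhs_filter x) _ _ _ _ cv (ctheta nu x)).
Qed.

Lemma nikaido_isoda_diag x : nikaido_isoda x x = 0.
Proof.
by rewrite /nikaido_isoda big1 // => nu _; rewrite unilateral_id subrr.
Qed.

Lemma nikaido_isoda_convex x y z (t : R) :
  (forall nu, player_convex nu (theta nu)) -> 0 <= t -> t <= 1 ->
  nikaido_isoda x (t *: y + (1 - t) *: z) <=
    t * nikaido_isoda x y + (1 - t) * nikaido_isoda x z.
Proof.
move=> ctheta t0 t1; rewrite /nikaido_isoda !mulr_sumr -big_split /=.
apply: ler_sum => nu _.
have : theta nu (unilateral x nu ((t *: y + (1 - t) *: z) nu)) <=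
    t * theta nu (unilateral x nu (y nu)) +
    (1 - t) * theta nu (unilateral x nu (z nu)).
  have := ctheta nu x (Itv01 t0 t1) (y nu) (z nu).
  by rewrite !in_setT => /(_ isT isT).
lra.
Qed.

Lemma nikaido_isoda_unilateral x nu (z : 'rV[R]_(n nu)) :
  nikaido_isoda x (unilateral x nu z) =
    theta nu (unilateral x nu z) - theta nu x.
Proof.
rewrite /nikaido_isoda (bigD1 nu) //= {2}/unilateral dfwithin.
rewrite big1 ?addr0 // => mu munu.
have -> : unilateral x nu z mu = x mu.
  by rewrite /unilateral dfwithout // eq_sym.
by rewrite unilateral_id subrr.
Qed.

End NikaidoIsoda.

(** * Existence of generalized Nash equilibria *)

Theorem theorem5p1 (R : realType) (N : finType) (N_nonempty : (0 < #|N|)%N)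
    (n : N -> nat) (nrm : profile R n -> R) (nrmP : is_norm nrm)
    (X : set (profile R n)) (theta : N -> profile R n -> R)
    (X_convex : convex_set X) (X_closed : closed X) (X_nonempty : X !=set0)
    (theta_continuous : forall nu : N, continuous (theta nu))
    (rho : R) (rho_gt0 : 0 < rho)
    (X_meets_ball : X `&` norm_closed_ball nrm rho !=set0)
    (coercivity : forall x, X x -> nrm x = rho ->
       exists y, [/\ X y, nrm y < rho &
         forall nu : N, theta nu (unilateral x nu (y nu)) <= theta nu x])
    (theta_convex : forall nu : N, player_convex nu (theta nu)) :
  RGNEP theta X !=set0.
Proof.
pose K := X `&` norm_closed_ball nrm rho.
have K_convex : convex_set K.
  apply/convex_setP => x y t [Xx xr] [Xy yr] t0 t1; split.
    exact: (convex_setP X).1.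
  apply: le_trans (nrm_convex nrmP x y t0 t1) _.
  by move: xr yr; rewrite /norm_closed_ball /=; nra.
have K_compact : compact K.
  apply: (subclosed_compact _ (@compact_norm_closed_ball _ _ _ _ nrmP rho)).
    by apply: closedI => //; apply: closed_norm_closed_ball.
  by move=> x [].
pose Psi := nikaido_isoda theta.
have [x [Xx xr] Psi_ge0] : exists2 x, K x & forall y, K y -> 0 <= Psi x y.
  apply: (@ky_fan R (profile R n) K Psi) => //.
  - by move=> y; apply: nikaido_isoda_continuous.
  - move=> x _; apply/convex_setP => y z t [Ky y0] [Kz z0] t0 t1; split.
      exact: (convex_setP K).1.
    apply: le_lt_trans (nikaido_isoda_convex x y z theta_convex t0 t1) _.
    rewrite -/Psi; nra.
  - by move=> x _; rewrite /Psi nikaido_isoda_diag.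
have [y0 [Xy0 y0r Psi_y0]] : exists y0, [/\ X y0, nrm y0 < rho & Psi x y0 <= 0].
  move: xr; rewrite /norm_closed_ball /= le_eqVlt.
  move=> /predU1P[xr|xr]; last first.
    by exists x; rewrite /Psi nikaido_isoda_diag.
  have [y [Xy yr theta_y]] := coercivity x Xx xr.
  exists y; split=> //; apply: sumr_le0 => nu _.
  by rewrite subr_le0.
exists x; split=> // nu z Xz.
pose y1 := unilateral x nu z.
rewrite -subr_ge0 -nikaido_isoda_unilateral -/y1 -/Psi.
have y1_ge0 := nrm_ge0 nrmP y1.
(* t is so small that t * y1 + (1 - t) * y0 stays in the ball. *)
pose t := Num.min 1 ((rho - nrm y0) / (nrm y1 + 1)).
have d_gt0 : 0 < nrm y1 + 1 by apply: ltr_wpDl.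
have t_gt0 : 0 < t by rewrite lt_min ltr01 divr_gt0 // subr_gt0.
have t_le1 : t <= 1 by rewrite ge_min lexx.
have t_small : t * (nrm y1 + 1) <= rho - nrm y0.
  by rewrite -ler_pdivlMr // ge_min lexx orbT.
have Kt : K (t *: y1 + (1 - t) *: y0).
  split.
    exact: ((convex_setP X).1 X_convex _ _ _ Xz Xy0 (ltW t_gt0) t_le1).
  apply: le_trans (nrm_convex nrmP y1 y0 (ltW t_gt0) t_le1) _.
  have := nrm_ge0 nrmP y0; nra.
have := nikaido_isoda_convex x y1 y0 theta_convex (ltW t_gt0) t_le1.
have := Psi_ge0 _ Kt; rewrite -/Psi -(pmulr_rge0 _ t_gt0).
have : (1 - t) * Psi x y0 <= 0 by rewrite mulr_ge0_le0 // subr_ge0.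
lra.
Qed.
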